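(* Let $d\in\{1,2,3\}$ and let $K\subset M^{m\times n}$ be a $d$-dimensional linear subspace. Then $\mathcal{M}^{pc}(K)$ consists of Dirac measures if and only if $K$ does not contain Rank-$1$ connections.
   Context: $M^{m\times n}$ denotes real $m\times n$ matrices. For $X\in M^{m\times n}$, $\hat X$ is the vector of all minors of $X$; $f$ is polyconvex if $f(X)=g(\hat X)$ with $g$ convex. For $\mathcal{K}\subset M^{m\times n}$, $\mathcal{M}^{pc}(\mathcal{K})$ is the set of probability measures $\nu$ with $\mathrm{Spt}\,\nu\subset\mathcal{K}$ and $\int f\,d\nu\ge f(\int X\,d\nu)$ for all polyconvex $f$ (equivalently $\nu$ commutes with all minors). A set $\Sigma$ has Rank-$1$ connections if there exist $A\ne B$ in $\Sigma$ with $\mathrm{Rank}(A-B)=1$. *)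

(* Defs.v *)
From HB Require Import structures.
From mathcomp Require Import all_boot all_order all_algebra.
From mathcomp Require Import all_classical all_reals all_analysis.
Set Implicit Arguments. Unset Strict Implicit. Unset Printing Implicit Defensive.
Import Order.TTheory GRing.Theory Num.Theory.
Import numFieldNormedType.Exports.
Local Open Scope classical_set_scope.
Local Open Scope ring_scope.

Definition BMat (R : realType) (m n : nat) :=
  g_sigma_algebraType (@open 'M[R]_(m, n)).

Definition incr_idx (k p : nat) (r : {ffun 'I_k -> 'I_p}) : bool :=
  [forall a : 'I_k, forall b : 'I_k, (a < b)%N ==> (r a < r b)%N].

(* Index set of all minors of an m x n matrix: a size k.+1 <= minn m n and
   strictly increasing choices of k.+1 rows and k.+1 columns. *)
Definition minor_idx (m n : nat) : finType :=
  {k : 'I_(minn m n) &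
     {rc : {ffun 'I_k.+1 -> 'I_m} * {ffun 'I_k.+1 -> 'I_n} |
        incr_idx rc.1 && incr_idx rc.2}}.

Definition minor (R : realType) (m n : nat) (s : minor_idx m n)
    (X : 'M[R]_(m, n)) : R :=
  \det (\matrix_(a < (tag s).+1, b < (tag s).+1)
          X ((sval (tagged s)).1 a) ((sval (tagged s)).2 b)).

Definition minors (R : realType) (m n : nat) (X : 'M[R]_(m, n))
  : {ffun minor_idx m n -> R} := [ffun s => minor s X].

Definition convex_fun (R : realType) (V : lmodType R) (g : V -> R) : Prop :=
  forall (u v : V) (t : R), 0 <= t <= 1 ->
    g (t *: u + (1 - t) *: v) <= t * g u + (1 - t) * g v.

Definition polyconvex (R : realType) (m n : nat) (f : 'M[R]_(m, n) -> R) : Prop :=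
  exists g : {ffun minor_idx m n -> R} -> R,
    convex_fun g /\ forall X, f X = g (minors X).

Definition barycenter (R : realType) (m n : nat)
    (nu : probability (BMat R m n) R) : 'M[R]_(m, n) :=
  \matrix_(i < m, j < n) Rintegral nu setT (fun X : BMat R m n => X i j).

(* M^{pc}(K): probability measures nu with Spt nu contained in K (K is closed,
   so this means nu(M \ K) = 0), for which all minors are nu-integrable (so
   that \int X dnu and \int f dnu make sense), and such that
   \int f dnu >= f(\int X dnu) for every polyconvex f. *)
Definition Mpc (R : realType) (m n : nat) (K : {vspace 'M[R]_(m, n)})
    (nu : probability (BMat R m n) R) : Prop :=
  [/\ nu [set X : BMat R m n | X \notin K] = 0%E,
      (forall s : minor_idx m n,
          nu.-integrable setT (fun X : BMat R m n => (minor s X)%:E)) &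
      (forall f : 'M[R]_(m, n) -> R, polyconvex f ->
          ((f (barycenter nu))%:E <= \int[nu]_(X in setT) (f X)%:E)%E)].

Definition is_dirac (R : realType) (m n : nat)
    (nu : probability (BMat R m n) R) : Prop :=
  exists A : BMat R m n,
    forall S : set (BMat R m n), measurable S -> nu S = \d_A S.

Definition has_rank1_connection (R : realType) (m n : nat)
    (K : {vspace 'M[R]_(m, n)}) : Prop :=
  exists A B : 'M[R]_(m, n), [/\ A \in K, B \in K, A != B & \rank (A - B) = 1%N].

(* Main.v *)
Require Import Defs.
From HB Require Import structures.
From mathcomp Require Import all_boot all_order all_algebra.
From mathcomp Require Import spectral complex ring lra.
From mathcomp Require Import all_classical all_reals all_analysis measurable_realfun.
Import Order.TTheory GRing.Theory Num.Theory.
Import numFieldNormedType.Exports.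
Local Open Scope ring_scope.

(** For a measure commuting with all minors, every 2x2 minor of X - A, where A is
    the barycenter, has integral zero.  Minimising the sum of the squares of the
    traces tr (Y Q_s Y^T), with Q_s the 2x2 minors restricted to K, over a unit
    sphere gives an alternative.  Either some linear combination of the Q_s is
    positive definite on K, and then X = A almost everywhere; or finitely many
    elements y_i of K, not all zero, satisfy sum_i Q_s (y_i) = 0 for all s.

    In the second case the slices B_a (row index a fixed) satisfy
    B_a^T G B_b = B_b^T G B_a for a positive definite G of size e <= 3.  A generic
    combination S of the B_a has the largest possible row space.  If S has rank e,
    then B_a = M_a S with the M_a commuting and selfadjoint, and a common
    eigenvector of the M_a yields a rank-one element of K.  The same works for the
    slices with the column index fixed.  Otherwise all elements of K considered have
    their rows in a common plane, and one of them kills a vector outside the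
    orthogonal complement of that plane, so that it has rank one.

    Conversely, minors of size at least 2 vanish on the line through a rank-one C,
    so the half-half mixture of the Dirac measures at 0 and C is in M^pc. *)

(** * Commuting selfadjoint matrices and isotropic families *)

Definition posdefmx (R : realFieldType) (e : nat) (G : 'M[R]_e) : Prop :=
  G^T = G /\ forall x : 'rV[R]_e, x != 0 -> 0 < (x *m G *m x^T) 0 0.

Lemma posdefmx_unit (R : realFieldType) (e : nat) (G : 'M[R]_e) :
  posdefmx R e G -> G \in unitmx.
Proof.
move=> [_ G0]; rewrite -row_free_unit -kermx_eq0; apply/eqP/row_matrixP => i.
rewrite row0; apply/eqP/negPn/negP => /G0.
by rewrite -row_mul mulmx_ker row0 mul0mx mxE ltxx.
Qed.

Lemma posdefmx_inv (R : realFieldType) (e : nat) (G : 'M[R]_e) :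
  posdefmx R e G -> posdefmx R e (invmx G).
Proof.
move=> PG; have uG := posdefmx_unit _ _ _ PG; case: PG => [sG G0].
have sV : (invmx G)^T = invmx G by rewrite trmx_inv sG.
split=> // x x0; have y0 : x *m invmx G != 0.
  by apply: contra x0 => /eqP E; rewrite -(mulmxKV uG x) E mul0mx.
by have := G0 _ y0; rewrite mulmxKV // trmx_mul sV mulmxA.
Qed.

(** A commuting family has a common eigenvector over [R[i]]. Symmetry of [M a *m H] makes its
    eigenvalues real, so every [M a] scales its real and imaginary parts, one of which is
    nonzero. *)
Lemma selfadjoint_common_eigenvector (R : rcfType) (e m : nat) (H : 'M[R]_e)
    (M : 'I_m -> 'M[R]_e) : (0 < e)%N -> posdefmx R e H ->
  (forall a, M a *m H = (M a *m H)^T) ->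
  (forall a b, M a *m M b = M b *m M a) ->
  exists2 x : 'rV[R]_e, x != 0 & exists l : 'I_m -> R, forall a, x *m M a = l a *: x.
Proof.
move=> e0 [sH H0] sa comM.
pose toC := real_complex R.
have [|v v0 /allP st] := @common_eigenvector R[i] e
    [seq map_mx toC (M a) | a <- enum 'I_m] e0.
  move=> _ _ /mapP[a _ ->] /mapP[b _ ->].
  by rewrite /comm_mx -!map_mxM comM.
pose p := map_mx (@complex.Re R) v; pose q := map_mx (@complex.Im R) v.
have vj j : v 0 j = (p 0 j +i* q 0 j)%C by rewrite !mxE; case: (v 0 j).
have eig a : exists l : R[i], v *m map_mx toC (M a) = l *: v.
  have : stablemx v (map_mx toC (M a)).
    by apply: st; apply/mapP; exists a; rewrite ?mem_enum.
  by move/sub_rVP.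
have ReIm a : exists al be : R, p *m M a = al *: p - be *: q /\
    q *m M a = al *: q + be *: p.
  have [[al be] E] := eig a; exists al, be.
  have key j : (v *m map_mx toC (M a)) 0 j
      = ((p *m M a) 0 j +i* (q *m M a) 0 j)%C.
    rewrite !mxE (eq_bigr (fun k => ((p 0 k * M a k j) +i* (q 0 k * M a k j))%C)).
      by apply/eqP; rewrite eq_complex /= !raddf_sum /= !eqxx.
    move=> k _; rewrite vj !mxE /toC /=; apply/eqP; rewrite eq_complex /=.
    by rewrite !mulr0 subr0 add0r mulrC eqxx /= mulrC.
  split; apply/rowP => j.
    have := key j; rewrite E mxE vj.
    by move/eqP; rewrite eq_complex /= => /andP[/eqP E1 _]; rewrite -E1 !mxE.
  have := key j; rewrite E mxE vj.
  by move/eqP; rewrite eq_complex /= => /andP[_ /eqP E2]; rewrite -E2 !mxE.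
have nneg (x : 'rV_e) : 0 <= (x *m H *m x^T) 0 0.
  by have [->|/H0/ltW//] := eqVneq x 0; rewrite !mul0mx mxE.
have pq : (p != 0) || (q != 0).
  rewrite -negb_and; apply: contra v0 => /andP[/eqP p0 /eqP q0].
  by apply/eqP/rowP => j; rewrite vj p0 q0 !mxE.
(* The two sides of the symmetry [p M H q^T = q M H p^T] differ by [be] times [p H p^T + q H q^T],
   which is positive. *)
have real a : exists al : R, p *m M a = al *: p /\ q *m M a = al *: q.
  have [al [be [Ep Eq]]] := ReIm a; exists al.
  suff be0 : be = 0 by rewrite Ep Eq be0 !scale0r subr0 addr0.
  have sy : (p *m M a *m H *m q^T) 0 0 = (q *m M a *m H *m p^T) 0 0.
    transitivity ((p *m M a *m H *m q^T)^T 0 0); first by rewrite [RHS]mxE.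
    by rewrite -(mulmxA p) trmx_mul trmxK trmx_mul -sa !mulmxA.
  have sy2 : (p *m H *m q^T) 0 0 = (q *m H *m p^T) 0 0.
    transitivity ((p *m H *m q^T)^T 0 0); first by rewrite [RHS]mxE.
    by rewrite trmx_mul trmxK trmx_mul sH mulmxA.
  have pos : 0 < (p *m H *m p^T) 0 0 + (q *m H *m q^T) 0 0.
    by case/orP: pq => /H0 ?; [apply: ltr_wpDr|apply: ltr_wpDl].
  have mE k (A B : 'rV[R]_e) : (k *: A *m H *m B^T) 0 0 = k * (A *m H *m B^T) 0 0.
    by rewrite -!scalemxAl mxE.
  have dE (A B C : 'rV[R]_e) :
      ((A + B) *m H *m C^T) 0 0 = (A *m H *m C^T) 0 0 + (B *m H *m C^T) 0 0.
    by rewrite !mulmxDl mxE.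
  have : be * ((p *m H *m p^T) 0 0 + (q *m H *m q^T) 0 0) = 0.
    move: sy; rewrite Ep Eq -scaleNr !dE !mE sy2 mulNr => /addrI/eqP.
    by rewrite eq_sym -addr_eq0 -mulrDr => /eqP.
  by move/eqP; rewrite mulf_eq0 (gt_eqF pos) orbF => /eqP.
have [l lE] : exists l : 'I_m -> R, forall a, p *m M a = l a *: p /\ q *m M a = l a *: q.
  by apply: (fin_all_exists real).
by case/orP: pq => z0; [exists p|exists q] => //; exists l => a; case: (lE a).
Qed.

(** With [J] a right inverse of [S], symmetry against [S] gives [B a = M a *m S], and pairwise
    symmetry makes the [M a] commute. A common eigenvector [x] yields the same row [w = x *m S] for
    all [a]. *)
Lemma selfadjoint_rank1 (R : rcfType) (e m n : nat) (G : 'M[R]_e)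
    (B : 'I_m -> 'M[R]_(e, n)) (S : 'M[R]_(e, n)) :
  (0 < e)%N -> posdefmx R e G -> row_free S ->
  (forall a, S^T *m G *m B a = (B a)^T *m G *m S) ->
  (forall a b, (B a)^T *m G *m B b = (B b)^T *m G *m B a) ->
  exists2 x : 'rV[R]_e, x != 0 & exists (u : 'I_m -> R) (w : 'rV[R]_n),
    forall a, x *m B a = u a *: w.
Proof.
move=> e0 PG /row_freeP[J SJ] symS symB.
have uG := posdefmx_unit _ _ _ PG; have [sG _] := PG.
have JS : J^T *m S^T = 1%:M by rewrite -trmx_mul SJ trmx1.
pose M a := invmx G *m (J^T *m (B a)^T *m G).
have GB a : G *m B a = J^T *m (B a)^T *m G *m S.
  by have := congr1 (mulmx J^T) (symS a); rewrite !mulmxA JS mul1mx.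
have BM a : B a = M a *m S by rewrite /M -mulmxA -GB mulKmx.
have GM a : G *m M a = (M a)^T *m G.
  by rewrite {1}/M mulKVmx // BM trmx_mul mulmxA JS mul1mx.
have comM a b : M a *m M b = M b *m M a.
  have E c d : G *m (M c *m M d) = J^T *m ((B c)^T *m G *m B d) *m J.
    rewrite !(BM c, BM d) trmx_mul !mulmxA JS mul1mx -GM -!mulmxA SJ mulmx1.
    by rewrite !mulmxA.
  by rewrite -[LHS](mulKmx uG) -[RHS](mulKmx uG) !E symB.
have [|x x0 [l xl]] := @selfadjoint_common_eigenvector R e m (invmx G) M e0
  (posdefmx_inv _ _ _ PG) _ comM.
  move=> a; rewrite trmx_mul trmx_inv sG.
  by rewrite -[(M a)^T](mulmxK uG) -GM -(mulmxA G) mulKmx.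
by exists x => //; exists l, (x *m S) => a; rewrite BM mulmxA xl scalemxAl.
Qed.

(* If the pencil A + k B failed to keep the joint row space for k = 0, ..., e,
   the witnesses would give e + 1 nonzero pairwise G-orthogonal vectors in R^e. *)
Lemma pencil_row_space (R : realFieldType) (e n : nat) (G : 'M[R]_e)
    (A B : 'M[R]_(e, n)) : posdefmx R e G ->
  A^T *m G *m B = B^T *m G *m A ->
  exists k : R, (A <= (A + k *: B)%R)%MS /\ (B <= (A + k *: B)%R)%MS.
Proof.
move=> [sG G0] symAB; pose P (k : 'I_e.+1) : 'M[R]_(e, n) := A + k%:R *: B.
suff [k Bk] : exists k, (B <= P k)%MS.
  have kB : (k%:R *: B <= P k)%MS by rewrite scalemx_sub.
  exists k%:R; split; last exact: Bk.
  rewrite -{1}(addrK (k%:R *: B) A).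
  by rewrite addmx_sub ?submx_refl // eqmx_opp scalemx_sub.
apply/existsP; rewrite -[X in is_true X]negbK; apply/negP.
rewrite negb_exists; move=> /forallP nB.
(* Inclusion of row spaces fails only if some vector killed by [P k], found among the columns of
   [cokermx (P k)], is not killed by [B]. *)
have /fin_all_exists[v vP] k : exists v : 'cV[R]_n, P k *m v = 0 /\ B *m v != 0.
  have := nB k; rewrite submxE => nz.
  have [j jP] : exists j, B *m col j (cokermx (P k)) != 0.
    apply/existsP; rewrite -[X in is_true X]negbK; apply/negP.
    rewrite negb_exists; move=> /forallP z.
    case/negP: nz; apply/eqP/matrixP => i j; have := z j.
    by rewrite negbK colE mulmxA -colE => /eqP/colP/(_ i); rewrite !mxE.
  by exists (col j (cokermx (P k))); split => //; rewrite colE mulmxA mulmx_coker mul0mx.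
have Av k : A *m v k = - (k%:R *: (B *m v k)).
  have [/eqP] := vP k; rewrite mulmxDl addr_eq0 => /eqP-> _.
  by rewrite scalemxAl.
pose ip k l := ((B *m v k)^T *m G *m (B *m v l)) 0 0.
(* Since [A *m v k] is [- k] times [B *m v k], the symmetry tested on [v k] and [v l] reads
   [k * ip k l = l * ip k l]. *)
have orth k l : k != l -> ip k l = 0.
  move=> kl; have E : ((v k)^T *m (A^T *m G *m B) *m v l) 0 0
    = ((v k)^T *m (B^T *m G *m A) *m v l) 0 0 by rewrite symAB.
  have L : (v k)^T *m (A^T *m G *m B) *m v l
      = - (k%:R *: ((B *m v k)^T *m G *m (B *m v l))).
    by rewrite scalemxAl scalemxAl -mulNmx -mulNmx -linearZ -linearN /= -Av
       trmx_mul !mulmxA.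
  have L' : (v k)^T *m (B^T *m G *m A) *m v l
      = - (l%:R *: ((B *m v k)^T *m G *m (B *m v l))).
    by rewrite scalemxAr -mulmxN -Av trmx_mul !mulmxA.
  have mN (c : R) (X : 'M[R]_1) : (- (c *: X)) 0 0 = - (c * X 0 0) by rewrite !mxE.
  move: E; rewrite {}L {}L' !mN -/(ip k l) => /eqP.
  rewrite eqr_opp -subr_eq0 -mulrBl mulf_eq0 => /orP[|/eqP//].
  by rewrite subr_eq0 eqr_nat => /eqP/val_inj klE; rewrite klE eqxx in kl.
pose W : 'M[R]_(e.+1, e) := \matrix_(k < e.+1) (B *m v k)^T.
have : row_free W.
  apply/inj_row_free => x xW; apply/rowP=> k; rewrite mxE; apply/eqP.
  have := congr1 (fun X : 'rV_e => (X *m G *m (B *m v k)) 0 0) xW.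
  rewrite /= !mul0mx [RHS]mxE (mulmx_sum_row x W) !mulmx_suml summxE (bigD1 k) //= big1.
    rewrite addr0 -!scalemxAl mxE rowK -/(ip k k) => /eqP.
    rewrite mulf_eq0 => /orP[//|]; have [_ Bv] := vP k.
    have := G0 (B *m v k)^T; rewrite trmxK -/(ip k k) trmx_eq0 => /(_ Bv).
    by move=> /gt_eqF ->.
  by move=> l lk; rewrite -!scalemxAl mxE rowK -/(ip l k) orth ?mulr0.
by move=> /eqP rW; have := rank_leq_col W; rewrite rW ltnn.
Qed.

(** Slices are absorbed one at a time: [pencil_row_space] adds a multiple of the next slice and
    keeps the row spaces already reached, and the symmetry relations are linear in [S]. *)
Lemma generic_combination (R : realFieldType) (e m n : nat) (G : 'M[R]_e)
    (B : 'I_m -> 'M[R]_(e, n)) : posdefmx R e G ->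
  (forall a b, (B a)^T *m G *m B b = (B b)^T *m G *m B a) ->
  exists S : 'M[R]_(e, n),
    (forall a, S^T *m G *m B a = (B a)^T *m G *m S) /\
    forall a, (B a <= S)%MS.
Proof.
move=> PG symB.
suff [S [cS SB]] : exists S : 'M[R]_(e, n),
    (forall a, S^T *m G *m B a = (B a)^T *m G *m S) /\
    forall a, a \in enum 'I_m -> (B a <= S)%MS.
  by exists S; split => // a; apply: SB; rewrite mem_enum.
elim: (enum 'I_m) => [|a s [S [cS SB]]].
  by exists 0; split => // a; rewrite trmx0 mulmx0 !mul0mx.
have [k [Sk Bk]] := @pencil_row_space _ _ _ _ _ _ PG (cS a).
exists (S + k *: B a); split => b.
  by rewrite linearD linearZ /= !mulmxDl mulmxDr cS -!scalemxAl -scalemxAr symB.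
by rewrite inE => /predU1P[->//|/SB]; move/submx_trans; apply.
Qed.

(** The entries of [x] are coefficients of a combination of matrices whose rows are spread over the
    slices; the product form says that this combination has rank at most one. *)
Lemma isotropic_rank1 (R : rcfType) (e m n : nat) (G : 'M[R]_e)
    (B : 'I_m -> 'M[R]_(e, n)) :
  (0 < e <= 3)%N -> posdefmx R e G ->
  (forall a b, (B a)^T *m G *m B b = (B b)^T *m G *m B a) ->
  exists2 x : 'rV[R]_e, x != 0 & exists (u : 'I_m -> R) (w : 'I_n -> R),
    forall a j, (x *m B a) 0 j = u a * w j.
Proof.
move=> /andP[e0 e3] PG symB.
have [S [cS SB]] := generic_combination _ _ _ _ _ _ PG symB.
have [fS|nfS] := boolP (row_free S).
  have [x x0 [u [w uw]]] := selfadjoint_rank1 _ _ _ _ _ _ _ e0 PG fS cS symB.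
  by exists x => //; exists u, (w 0) => a j; rewrite uw mxE.
(* The bound [e <= 3] enters here: a row space of dimension less than [e] is at most a plane. *)
have r2 : (\rank S <= 2)%N.
  have := rank_leq_row S; rewrite leq_eqVlt => /orP[rS|rS]; first by rewrite /row_free rS in nfS.
  by rewrite -ltnS (leq_trans rS).
have Bz a : exists z, B a = z *m row_base S.
  by apply/submxP; rewrite eq_row_base.
move: (row_base S) (row_base_free S) Bz r2; case: (\rank S) => [|r] T fT Bz r2.
  (* In rank zero all slices vanish and any nonzero [x] will do. *)
  exists (const_mx 1).
    by apply/eqP => /rowP/(_ (Ordinal e0)); rewrite !mxE => /eqP; rewrite oner_eq0.
  exists (fun=> 0), (fun=> 0) => a j; have [z ->] := Bz a.
  by rewrite (flatmx0 T) !mulmx0 mxE mul0r.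
(* The vector [p] pairs to one with the first row of [T] and to zero with the other row, if any, so
   it reads off the first coordinate in the basis [T]. *)
have /row_freeP[J TJ] := fT; pose p := col 0 J.
have Tp : T *m p = delta_mx 0 0 by rewrite /p colE mulmxA TJ mul1mx.
(* The same array sliced by column index: the Gram entries are the same numbers with index pairs
   exchanged, so the symmetry carries over. *)
pose C (b : 'I_n) : 'M[R]_(e, m) := \matrix_(j, a) B a j b.
have ipC b b' a a' : ((C b)^T *m G *m C b') a a' = ((B a)^T *m G *m B a') b b'.
  rewrite !mxE; apply: eq_bigr => k _; rewrite !mxE; congr (_ * _).
  by apply: eq_bigr => l _; rewrite !mxE.
have symC b b' : (C b)^T *m G *m C b' = (C b')^T *m G *m C b.
  apply/matrixP => a a'; rewrite !ipC {1}symB.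
  transitivity (((B a)^T *m G *m B a')^T b b'); last by rewrite [LHS]mxE.
  by rewrite trmx_mul trmx_mul trmxK (proj1 PG) mulmxA.
pose Cp := \sum_b p b 0 *: C b.
have CpE (x : 'rV_e) a : (x *m Cp) 0 a = (x *m B a *m p) 0 0.
  rewrite mulmx_sumr summxE mxE; apply: eq_bigr => b _.
  rewrite -scalemxAr mxE mulrC; congr (_ * _).
  by rewrite !mxE; apply: eq_bigr => j _; rewrite mxE.
have symCp b : Cp^T *m G *m C b = (C b)^T *m G *m Cp.
  rewrite linear_sum mulmx_suml mulmx_suml mulmx_sumr; apply: eq_bigr => c _.
  by rewrite linearZ /= -!scalemxAl -scalemxAr symC.
(* If [Cp] is row free, it serves as [S] for the column slices. Otherwise a left kernel vector [x]
   makes the first [T]-coordinate of every [x *m B a] vanish, leaving multiples of the last row of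
   [T]. *)
have [fCp|] := boolP (row_free Cp).
  have [x x0 [u [w uw]]] := selfadjoint_rank1 _ _ _ _ _ _ _ e0 PG fCp symCp symC.
  exists x => //; exists (w 0), u => a j; rewrite mulrC.
  have := congr1 (fun X : 'rV_m => X 0 a) (uw j); rewrite /= [RHS]mxE => <-.
  by rewrite !mxE; apply: eq_bigr => k _; rewrite mxE.
rewrite -kermx_eq0 => /rowV0Pn[x /sub_kermxP xCp x0].
have /fin_all_exists[z zE] := Bz.
exists x => //; exists (fun a => (x *m z a) 0 ord_max), (T ord_max) => a j.
have z0 : (x *m z a) 0 0 = 0.
  have := CpE x a; rewrite xCp mxE zE mulmxA -mulmxA Tp.
  by rewrite -colE mxE => <-.
rewrite zE mulmxA mxE (bigD1 ord_max) //= big1 ?addr0 // => k kmax.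
suff -> : k = 0 by rewrite z0 mul0r.
have kr : (k < r)%N.
  rewrite ltn_neqAle -ltnS ltn_ord andbT.
  by apply: contra kmax => /eqP kE; apply/eqP/val_inj.
by apply/val_inj/eqP; rewrite /= -leqn0 -ltnS (leq_trans kr).
Qed.

(** * An alternative for families of quadratic forms *)

Lemma continuous_sumr (R : realType) (T : topologicalType) (I : finType)
    (F : I -> T -> R) : (forall i, continuous (F i)) ->
  continuous (fun x => \sum_i F i x).
Proof. by move=> cF; apply: continuous_big => //; exact: add_continuous. Qed.

Lemma continuous_mulr (R : realType) (T : topologicalType) (f g : T -> R) :
  continuous f -> continuous g -> continuous (fun x => f x * g x).
Proof. by move=> cf cg x; apply: cvgM; [exact: cf|exact: cg]. Qed.

Lemma mxtrace_quad (R : comRingType) (k d : nat) (Y : 'M[R]_(k, d)) (Q : 'M[R]_d) :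
  \tr (Y *m Q *m Y^T) = \sum_i \sum_j \sum_l Y i l * Q l j * Y i j.
Proof.
apply: eq_bigr => i _; rewrite mxE; apply: eq_bigr => j _.
by rewrite !mxE mulr_suml.
Qed.

Lemma mxtrace_gram_gt0 (R : realType) (k d : nat) (Y : 'M[R]_(k, d)) :
  Y != 0 -> 0 < \tr (Y *m Y^T).
Proof.
move=> Y0; have nneg i j : 0 <= Y i j * Y^T j i by rewrite mxE -expr2 sqr_ge0.
have nn i : 0 <= (Y *m Y^T) i i by rewrite mxE sumr_ge0.
rewrite lt_neqAle sumr_ge0 // andbT eq_sym; apply: contra Y0.
rewrite psumr_eq0 // => /allP H; apply/eqP/matrixP => i j.
have := H i (mem_index_enum _); rewrite mxE psumr_eq0 // => /allP/(_ j (mem_index_enum _)).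
by rewrite !mxE -expr2 sqrf_eq0 => /eqP.
Qed.

(** The sphere is closed and lies in a cube with sides [[-1, 1]], hence is compact. *)
Lemma tr_sphere_EVT_min (R : realType) (k d : nat) (F : 'M[R]_(k, d) -> R) :
  (0 < k)%N -> (0 < d)%N ->
  continuous (fun v : 'rV[R]_(k * d) => F (vec_mx v)) ->
  exists2 Y, \tr (Y *m Y^T) = 1 & forall Z, \tr (Z *m Z^T) = 1 -> F Y <= F Z.
Proof.
move=> k0 d0 cF.
pose N (v : 'rV[R]_(k * d)) := \tr (vec_mx v *m (vec_mx v)^T).
have NE v : N v = \sum_i \sum_j vec_mx v i j * vec_mx v i j.
  by apply: eq_bigr => i _; rewrite mxE; apply: eq_bigr => j _; rewrite !mxE.
have cN : continuous N.
  have -> : N = (fun v => \sum_i \sum_j vec_mx v i j * vec_mx v i j) by apply/funext.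
  apply: continuous_sumr => i; apply: continuous_sumr => j.
  have -> : (fun v : 'rV[R]_(k * d) => vec_mx v i j * vec_mx v i j)
    = (fun v => v 0 (mxvec_index i j) * v 0 (mxvec_index i j)).
    by apply/funext => v; rewrite mxE.
  by apply: continuous_mulr; exact: coord_continuous.
pose S := (N @^-1` [set 1])%classic.
have Sne : (S !=set0)%classic.
  pose Y : 'M[R]_(k, d) := delta_mx (Ordinal k0) (Ordinal d0).
  exists (mxvec Y); rewrite /S /= /N mxvecK /Y trmx_delta mul_delta_mx.
  rewrite /mxtrace (bigD1 (Ordinal k0)) //= big1 ?addr0 ?mxE ?eqxx //.
  by move=> i /negPf ik; rewrite mxE ik.
have cS : compact S.
  apply: (subclosed_compact _ (@rV_compact R (k * d) (fun=> `[-1, 1]%classic) _)).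
  - by apply: preimage_closed => [v _|]; [exact: cN|exact: closed_eq].
  - by move=> _; exact: segment_compact.
  move=> v; rewrite /S /= NE => v1 i; case/mxvec_indexP: i => i j.
  have : v 0 (mxvec_index i j) ^+ 2 <= 1.
    rewrite -v1 (bigD1 i) //= (bigD1 j) //= mxE -expr2 -addrA lerDl.
    by rewrite addr_ge0 ?sumr_ge0 // => *; rewrite ?sumr_ge0 // => *; rewrite -expr2 sqr_ge0.
  rewrite in_itv /= -ler_norml -[_ ^+ 2]ger0_norm ?sqr_ge0 // normrX.
  by rewrite expr_le1.
have [v vS vmin] := EVT_min_rV Sne cS (continuous_subspaceT cF).
exists (vec_mx v); first by move: vS; rewrite inE.
move=> Z Z1; rewrite -[Z]mxvecK; apply: vmin; rewrite inE /S /= /N.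
by rewrite mxvecK.
Qed.

(** If the minimum of [F] on the sphere is positive, the traces at the minimiser [Y] serve as the
    coefficients [c]. Having [d.+1] rows, [Y] has a left kernel vector [u], and the perturbations
    [t *: (u^T *m x)] test positivity at [x]. *)
Lemma quad_alternative (R : realType) (d : nat) (I : finType) (Q : I -> 'M[R]_d) :
  (exists c : I -> R, forall x : 'rV[R]_d, x != 0 ->
     0 < \sum_s c s * (x *m Q s *m x^T) 0 0)
  \/ (exists2 Y : 'M[R]_(d.+1, d), Y != 0 &
     forall s, \tr (Y *m Q s *m Y^T) = 0).
Proof.
have [d0|d0] := posnP d.
  left; exists (fun=> 0) => x; case/eqP; apply/rowP => -[j jd]; exfalso.
  by rewrite d0 in jd.
pose q s (Y : 'M[R]_(d.+1, d)) := \tr (Y *m Q s *m Y^T).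
pose F Y := \sum_s q s Y ^+ 2.
have cF : continuous (fun v : 'rV[R]_(d.+1 * d) => F (vec_mx v)).
  apply: continuous_sumr => s; rewrite (_ : (fun _ => _) =
    (fun v : 'rV[R]_(d.+1 * d) => q s (vec_mx v) * q s (vec_mx v))); last first.
    by apply/funext.
  suff cq : continuous (fun v : 'rV[R]_(d.+1 * d) => q s (vec_mx v)) by apply: continuous_mulr.
  have -> : (fun v : 'rV[R]_(d.+1 * d) => q s (vec_mx v)) = (fun v => \sum_i \sum_j \sum_l
     v 0 (mxvec_index i l) * Q s l j * v 0 (mxvec_index i j)).
    apply/funext => v; rewrite /q mxtrace_quad; do 3 (apply: eq_bigr => ? _).
    by rewrite !mxE.
  do 3 (apply: continuous_sumr => ?); do 2?(apply: continuous_mulr);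
   [exact: coord_continuous|exact: cst_continuous|exact: coord_continuous].
have [Y Y1 Ymin] := @tr_sphere_EVT_min R d.+1 d F isT d0 cF.
have Y0 : Y != 0.
  by apply/eqP => YE; move: Y1; rewrite YE mul0mx mxtrace0 => /esym/eqP; rewrite oner_eq0.
have F_ge0 Z : 0 <= F Z by apply: sumr_ge0 => s _; rewrite sqr_ge0.
(* [F] is homogeneous of degree four, so minimality on the sphere extends to all matrices. *)
have Fhom Z : F Y * \tr (Z *m Z^T) ^+ 2 <= F Z.
  have [->|/mxtrace_gram_gt0 Zgt] := eqVneq Z 0; first by rewrite mul0mx mxtrace0 expr0n mulr0.
  pose t := Num.sqrt (\tr (Z *m Z^T)).
  have t2 : t ^+ 2 = \tr (Z *m Z^T) by rewrite sqr_sqrtr // ltW.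
  have t0 : t != 0 by rewrite sqrtr_eq0 -ltNge.
  have qt s : q s (t^-1 *: Z) = t ^- 2 * q s Z.
    by rewrite /q linearZ /= -!scalemxAl -scalemxAr !mxtraceZ mulrA -expr2 exprVn.
  have : F Y <= F (t^-1 *: Z).
    apply: Ymin; rewrite linearZ /= -scalemxAl -scalemxAr !mxtraceZ -t2 mulrA -expr2.
    by rewrite exprVn mulVf // expf_neq0.
  have -> : F (t^-1 *: Z) = (t ^- 2) ^+ 2 * F Z.
    by rewrite /F mulr_sumr; apply: eq_bigr => s _; rewrite qt exprMn.
  rewrite -t2 exprVn mulrC ler_pdivlMr //.
  by rewrite exprn_gt0 // exprn_even_gt0 //= t0.
have [F0|Fgt] := eqVneq (F Y) 0.
  right; exists Y => // s; move/eqP: F0.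
  rewrite psumr_eq0 => [/allP/(_ s)|? _]; last by rewrite sqr_ge0.
  by rewrite mem_index_enum sqrf_eq0 => /(_ isT)/eqP.
have {}Fgt : 0 < F Y by rewrite lt_neqAle eq_sym Fgt F_ge0.
left; exists (fun s => q s Y) => x x0.
have /rowV0Pn[u /sub_kermxP uY u0] : kermx Y != 0.
  by rewrite kermx_eq0 /row_free ltn_eqF // ltnS rank_leq_col.
pose rho := \tr (u *m u^T); have rho0 : 0 < rho by exact: mxtrace_gram_gt0.
pose X := \tr (x *m x^T); have X0 : 0 < X by exact: mxtrace_gram_gt0.
pose b s := (x *m Q s *m x^T) 0 0.
pose Z t := Y + t *: (u^T *m x).
have uYT : Y^T *m u^T = 0 by rewrite -trmx_mul uY trmx0.
(* Since [u *m Y = 0], the terms linear in [t] vanish. *)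
have key (M : 'M[R]_d) t :
    \tr (Z t *m M *m (Z t)^T) = \tr (Y *m M *m Y^T) + t ^+ 2 * rho * (x *m M *m x^T) 0 0.
  rewrite /Z linearD linearZ /= trmx_mul trmxK !(mulmxDl, mulmxDr) !mxtraceD.
  rewrite -!scalemxAl -!scalemxAr !mxtraceZ.
  have -> : \tr (Y *m M *m (x^T *m u)) = 0.
    by rewrite mulmxA mxtrace_mulC !mulmxA uY !mul0mx mxtrace0.
  have -> : \tr (u^T *m x *m M *m Y^T) = 0.
    by rewrite -!mulmxA mxtrace_mulC -!mulmxA uYT !mulmx0 mxtrace0.
  have -> : \tr (u^T *m x *m M *m (x^T *m u)) = rho * (x *m M *m x^T) 0 0.
    rewrite (_ : _ *m _ = u^T *m ((x *m M *m x^T) *m u)); last by rewrite !mulmxA.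
    move: (x *m M *m x^T) => A; rewrite mxtrace_mulC -mulmxA {1}[A]mx11_scalar.
    by rewrite mul_scalar_mx mxtraceZ mulrC.
  by rewrite !mulr0 !addr0 expr2 -!mulrA add0r.
have FZ t : F (Z t) = F Y + 2 * (t ^+ 2 * rho) * (\sum_s q s Y * b s)
    + (t ^+ 2 * rho) ^+ 2 * \sum_s b s ^+ 2.
  have kq s : q s (Z t) = q s Y + t ^+ 2 * rho * b s by exact: key.
  move: (t ^+ 2 * rho) kq => r kq.
  rewrite /F !mulr_sumr -!big_split; apply: eq_bigr => s _ /=.
  by rewrite kq; ring.
have NZ t : \tr (Z t *m (Z t)^T) = 1 + t ^+ 2 * rho * X.
  have := key 1%:M t; rewrite !mulmx1 Y1 => ->.
  by rewrite /X /mxtrace big_ord1.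
set B := \sum_s q s Y * b s; rewrite ltNge; apply/negP => B0.
pose B2 := \sum_s b s ^+ 2.
have B20 : 0 <= B2 by apply: sumr_ge0 => s _; rewrite sqr_ge0.
(* The value given to [t ^+ 2 * rho]: small enough that [w ^+ 2 * B2 < w * (F Y * X)], which
   contradicts minimality when [B <= 0]. The [+ 1] keeps the denominator positive. *)
pose w := F Y * X / (B2 + 1).
have w0 : 0 < w by rewrite divr_gt0 ?mulr_gt0 // ltr_wpDl.
have := Fhom (Z (Num.sqrt (w / rho))).
rewrite FZ NZ sqr_sqrtr; last by rewrite ltW // divr_gt0.
rewrite divfK ?gt_eqF // -/B -/B2.
have wE : w * (B2 + 1) = F Y * X by rewrite divfK // gt_eqF // ltr_wpDl.
have h1 : 0 <= w * - B by rewrite mulr_ge0 ?oppr_ge0 // ltW.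
have h2 : 0 < w * (F Y * X) by rewrite mulr_gt0 // mulr_gt0.
have h3 : w * (F Y * X) = w ^+ 2 * B2 + w ^+ 2 by rewrite -wE; ring.
have h4 : 0 <= F Y * (w * X) ^+ 2 by rewrite mulr_ge0 // sqr_ge0.
have h5 : 0 <= w ^+ 2 by rewrite sqr_ge0.
move=> h; have : F Y * (1 + w * X) ^+ 2 = F Y + 2 * (w * (F Y * X)) + F Y * (w * X) ^+ 2.
  by ring.
by lra.
Qed.

(** * The 2x2 minors on a subspace without rank-one elements *)

(** The index pairs need be neither increasing nor distinct, so the symmetry of slices can be read
    off for all pairs at once. *)
Definition det2 (R : ringType) (m n : nat) (X : 'M[R]_(m, n))
    (s : 'I_m * 'I_m * ('I_n * 'I_n)) : R :=
  X s.1.1 s.2.1 * X s.1.2 s.2.2 - X s.1.1 s.2.2 * X s.1.2 s.2.1.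

Lemma rank1_of_product (R : realType) (m n : nat) (X : 'M[R]_(m, n))
    (u : 'I_m -> R) (w : 'I_n -> R) :
  (forall a b, X a b = u a * w b) -> X != 0 -> \rank X = 1%N.
Proof.
move=> XE X0; apply/eqP; rewrite eqn_leq lt0n mxrank_eq0 X0 andbT.
have -> : X = (\col_a u a) *m (\row_b w b).
  by apply/matrixP => a b; rewrite !mxE big_ord1 !mxE.
by rewrite (leq_trans (mxrankM_maxl _ _)) // rank_leq_col.
Qed.

Lemma posdefmx_gram (R : realType) (k e : nat) (Z : 'M[R]_(k, e)) :
  row_full Z -> posdefmx R e (Z^T *m Z).
Proof.
move=> fZ; split=> [|x x0]; first by rewrite trmx_mul trmxK.
have fZT : row_free Z^T by rewrite /row_free mxrank_tr.
have /mxtrace_gram_gt0 : x *m Z^T != 0 by rewrite mulmx_free_eq0.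
by rewrite /mxtrace big_ord1 trmx_mul trmxK !mulmxA.
Qed.

(** In coordinates on [K] each 2x2 minor is a quadratic form [Q s], so [quad_alternative] applies;
    its second case produces a rank-one element of [K], connected to zero. *)
Lemma elliptic_det2 (R : realType) (m n : nat) (K : {vspace 'M[R]_(m, n)}) :
  (0 < \dim K <= 3)%N -> ~ has_rank1_connection K ->
  exists c : 'I_m * 'I_m * ('I_n * 'I_n) -> R,
    forall X, X \in K -> X != 0 -> 0 < \sum_s c s * det2 R m n X s.
Proof.
move=> /andP[K0 K3] noconn; set d := \dim K in K0 K3.
pose vb := vbasis K; pose psi (x : 'rV[R]_d) := \sum_j x 0 j *: vb`_j.
pose B (a : 'I_m) : 'M[R]_(d, n) := \matrix_(j, b) vb`_j a b.
have psiE x a b : psi x a b = (x *m B a) 0 b.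
  by rewrite summxE mxE; apply: eq_bigr => j _; rewrite !mxE.
have psiK x : psi x \in K.
  apply: memv_suml => j _; apply: memvZ; apply: vbasis_mem.
  by rewrite mem_nth // size_tuple.
have psi_onto X : X \in K -> exists x, X = psi x.
  move=> XK; exists (\row_j coord vb j X).
  by rewrite {1}(coord_vbasis XK); apply: eq_bigr => j _; rewrite mxE.
have psi0 x : psi x = 0 -> x = 0.
  move=> x0; apply/rowP => j; rewrite mxE.
  have /freeP := basis_free (vbasisP K); apply.
  exact: x0.
pose Q (s : 'I_m * 'I_m * ('I_n * 'I_n)) : 'M[R]_d :=
  col s.2.1 (B s.1.1) *m (col s.2.2 (B s.1.2))^T
  - col s.2.2 (B s.1.1) *m (col s.2.1 (B s.1.2))^T.
have xcol (k : nat) (Y : 'M[R]_(k, d)) a b : Y *m col b (B a) = col b (Y *m B a).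
  by rewrite !colE mulmxA.
have QE (k : nat) (Y : 'M[R]_(k, d)) s i : (Y *m Q s *m Y^T) i i =
   (Y *m B s.1.1) i s.2.1 * (Y *m B s.1.2) i s.2.2
   - (Y *m B s.1.1) i s.2.2 * (Y *m B s.1.2) i s.2.1.
  have E b b' a a' : (Y *m (col b (B a) *m (col b' (B a'))^T) *m Y^T) i i =
      (Y *m B a) i b * (Y *m B a') i b'.
    rewrite mulmxA -mulmxA -trmx_mul !xcol.
    by rewrite mxE big_ord1 [X in X * _]mxE [X in _ * X]mxE [X in _ * X]mxE.
  by rewrite mulmxBr mulmxBl mxE [X in _ + X]mxE !E.
have [[c cP]|[Y Y0 YQ]] := quad_alternative R d _ Q.
  exists c => X XK X0; have [x XE] := psi_onto _ XK.
  have x0 : x != 0.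
    apply: contra X0 => /eqP x0; rewrite XE x0 /psi big1 // => j _.
    by rewrite mxE scale0r.
  have := cP x x0; rewrite (eq_bigr (fun s => c s * det2 R m n X s)) // => s _.
  by rewrite QE /det2 XE !psiE.
exfalso; apply: noconn.
(* The rank factorisation [Y = Z *m T] turns sums over the rows of [Y] into the positive definite
   form [Z^T *m Z], of size [\rank Y <= 3]. *)
pose T := row_base Y; pose Z := col_base Y.
have YE : Z *m T = Y by rewrite mulmx_base.
have PG : posdefmx R _ (Z^T *m Z) by apply: posdefmx_gram; exact: col_base_full.
have e0 : (0 < \rank Y <= 3)%N.
  by rewrite lt0n mxrank_eq0 Y0 (leq_trans (rank_leq_col _)).
have gramE a a' : (T *m B a)^T *m (Z^T *m Z) *m (T *m B a') = (Y *m B a)^T *m (Y *m B a').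
  transitivity ((Z *m T *m B a)^T *m (Z *m T *m B a')); last by rewrite YE.
  by rewrite !trmx_mul !mulmxA.
(* Entry by entry, the asymmetry is one 2x2 minor summed over the rows of [Y], which is the trace
   that vanishes. *)
have sym a a' : (T *m B a)^T *m (Z^T *m Z) *m (T *m B a')
    = (T *m B a')^T *m (Z^T *m Z) *m (T *m B a).
  rewrite !gramE; apply/matrixP => b b'; apply/eqP; rewrite -subr_eq0; apply/eqP.
  rewrite -(YQ ((a, a'), (b, b'))) /mxtrace !mxE -sumrB.
  apply: eq_bigr => i _; rewrite QE /= [in X in X - _]mxE [in X in _ - X]mxE.
  by congr (_ - _); rewrite mulrC.
have [x x0 [u [w xw]]] := isotropic_rank1 _ _ _ _ _ _ e0 PG sym.
have X0 : psi (x *m T) != 0.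
  apply: contra x0 => /eqP/psi0/eqP.
  by rewrite mulmx_free_eq0 // row_base_free.
exists (psi (x *m T)), 0; split => //; first exact: mem0v.
rewrite subr0; apply: (@rank1_of_product R m n _ u w) => // a b.
by rewrite psiE -mulmxA xw.
Qed.

(** * Measures commuting with minors *)

Local Open Scope classical_set_scope.

Definition commutes_at (d : measure_display) (T : measurableType d) (R : realType)
    (nu : probability T R) (A : T) (f : T -> R) : Prop :=
  nu.-integrable setT (fun x => (f x)%:E) /\
  (\int[nu]_(x in setT) (f x)%:E = (f A)%:E)%E.

Section commutes_at.
Context (d : measure_display) (T : measurableType d) (R : realType).
Variables (nu : probability T R) (A : T).
Local Notation commutes := (commutes_at d T R nu A).

Lemma commutes_cst (k : R) : commutes (fun=> k).
Proof.
split; first exact: finite_measure_integrable_cst.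
by rewrite integral_cst //= probability_setT mule1.
Qed.

Lemma commutesD (f g : T -> R) :
  commutes f -> commutes g -> commutes (fun x => f x + g x).
Proof.
move=> [fi fE] [gi gE]; rewrite /commutes_at.
under eq_fun do rewrite EFinD.
split; first exact: integrableD.
by rewrite integralD // fE gE EFinD.
Qed.

Lemma commutesZ (k : R) (f : T -> R) : commutes f -> commutes (fun x => k * f x).
Proof.
move=> [fi fE]; rewrite /commutes_at.
under eq_fun do rewrite EFinM.
split; first exact: integrableZl.
by rewrite integralZl // fE EFinM.
Qed.

Lemma commutes_sum (I : finType) (f : I -> T -> R) :
  (forall i, commutes (f i)) -> commutes (fun x => \sum_i f i x).
Proof.
move=> cf; elim: (index_enum I) => [|i s IHs].
  by under eq_fun do rewrite big_nil; exact: commutes_cst.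
by under eq_fun do rewrite big_cons; exact: commutesD.
Qed.

Lemma commutes_ae_eq0 (f : T -> R) : commutes f ->
  {ae nu, forall x, f x = 0} -> f A = 0.
Proof.
move=> [fi fE] f0; apply: EFin_inj; rewrite -fE.
rewrite (ae_eq_integral (cst 0%E)) ?integral0 //; first exact: measurable_int fi.
by apply: filterS f0 => x fx _; rewrite fx.
Qed.

Lemma commutes_ae_ge0 (f : T -> R) : commutes f -> f A = 0 ->
  {ae nu, forall x, 0 <= f x} -> {ae nu, forall x, f x = 0}.
Proof.
move=> [fi fE] fA f0; have mf := measurable_int _ fi.
have /(ae_eq_integral_abs nu measurableT mf) : (\int[nu]_(x in setT) `|(f x)%:E| = 0)%E.
  rewrite -[RHS]/(0%:E) -fA -fE; apply: ae_eq_integral => //.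
    exact: measurableT_comp.
  by apply: filterS f0 => x fx _; rewrite gee0_abs // lee_fin.
by apply: filterS => x fx; apply: EFin_inj; exact: fx.
Qed.

End commutes_at.

(** * Minors of sizes one and two *)

Lemma minor_idx_of_ffun (R : realType) (m n k : nat)
    (r : {ffun 'I_k.+1 -> 'I_m}) (c : {ffun 'I_k.+1 -> 'I_n}) :
  (k < minn m n)%N -> incr_idx r -> incr_idx c ->
  exists t : minor_idx m n, forall X : 'M[R]_(m, n),
    minor t X = \det (\matrix_(a < k.+1, b < k.+1) X (r a) (c b)).
Proof.
move=> kmn ir ic; have rc : incr_idx (r, c).1 && incr_idx (r, c).2 by rewrite ir.
by exists (existT (fun k : 'I_(minn m n) =>
  {rc : {ffun 'I_k.+1 -> 'I_m} * {ffun 'I_k.+1 -> 'I_n} |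
     incr_idx rc.1 && incr_idx rc.2}) (Ordinal kmn) (exist _ (r, c) rc)).
Qed.

Lemma minor_entry (R : realType) (m n : nat) (a : 'I_m) (b : 'I_n) :
  exists t : minor_idx m n, forall X : 'M[R]_(m, n), minor t X = X a b.
Proof.
have incr1 p (i : 'I_p) : incr_idx ([ffun=> i] : {ffun 'I_1 -> 'I_p}).
  by apply/forallP => j; apply/forallP => k; rewrite !ord1.
have [|t tE] := minor_idx_of_ffun R m n 0 [ffun=> a] [ffun=> b] _ (incr1 _ a) (incr1 _ b).
  by rewrite leq_min (leq_ltn_trans (leq0n a)) // (leq_ltn_trans (leq0n b)).
by exists t => X; rewrite tE det_mx11 mxE !ffunE.
Qed.

Lemma minor_det2 (R : realType) (m n : nat) (a a' : 'I_m) (b b' : 'I_n) :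
  (a < a')%N -> (b < b')%N ->
  exists t : minor_idx m n, forall X : 'M[R]_(m, n),
    minor t X = det2 R m n X ((a, a'), (b, b')).
Proof.
move=> aa' bb'.
pose pr p (i i' : 'I_p) : {ffun 'I_2 -> 'I_p} := [ffun k : 'I_2 => if k == 0 then i else i'].
have incr2 p (i i' : 'I_p) : (i < i')%N -> incr_idx (pr p i i').
  move=> ii'; apply/forallP => -[[|[|//]] j0]; apply/forallP => -[[|[|//]] k0] //=.
  by rewrite !ffunE.
have [|t tE] := minor_idx_of_ffun R m n 1 _ _ _ (incr2 _ _ _ aa') (incr2 _ _ _ bb').
  have gt1 p (i i' : 'I_p) : (i < i')%N -> (1 < p)%N.
    by move=> ii'; rewrite (leq_ltn_trans _ (ltn_ord i')) // (leq_ltn_trans (leq0n i)).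
  by rewrite leq_min (gt1 _ _ _ aa') (gt1 _ _ _ bb').
exists t => X; rewrite tE (expand_det_row _ 0) !big_ord_recl big_ord0 /cofactor !det_mx11.
by rewrite !mxE !ffunE /= expr0 expr1 mul1r mulN1r addr0 mulrN /det2 /=.
Qed.

(** * Minors under measures in M^pc *)

Section Mpc.
Context (R : realType) (m n : nat) (K : {vspace 'M[R]_(m, n)}).
Variable nu : probability (BMat R m n) R.
Hypothesis nuK : Mpc K nu.
Let A : BMat R m n := barycenter nu.
Local Notation commutes := (commutes_at _ _ R nu A).

(** A minor and its negative are both linear in the vector of minors, hence polyconvex; the two
    inequalities give equality. *)
Lemma commutes_minor (s : minor_idx m n) : commutes (fun X => minor s X).
Proof.
have [_ /(_ s) si pc] := nuK; split => //.
apply/eqP; rewrite eq_le; apply/andP; split; last first.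
  apply: (pc (fun X => minor s X)); exists (fun v => v s); split => [u v t _|X].
    by rewrite !ffunE.
  by rewrite ffunE.
have := pc (fun X => - minor s X) _.
rewrite (_ : (\int[nu]_(X in setT) (- minor s X)%:E)%E
  = (- \int[nu]_(X in setT) (minor s X)%:E)%E); last first.
  by under eq_integral do rewrite EFinN; rewrite integralN // integrable_add_def.
rewrite EFinN leeN2; apply.
exists (fun v => - v s); split => [u v t _|X]; last by rewrite ffunE.
by rewrite !ffunE opprD !mulrN.
Qed.

Lemma commutes_entry a b : commutes (fun X => X a b).
Proof.
have [t tE] := minor_entry R m n a b; have := commutes_minor t.
by rewrite /commutes_at; under eq_fun do rewrite tE; rewrite tE.
Qed.

(** Increasing pairs give genuine minors; exchanging rows or columns changes the sign, and repeated
    indices give zero. *)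
Lemma commutes_det2 s : commutes (fun X => det2 R m n X s).
Proof.
have lt (a a' : 'I_m) (b b' : 'I_n) : (a < a')%N -> (b < b')%N ->
    commutes (fun X => det2 R m n X ((a, a'), (b, b'))).
  move=> aa' bb'; have [t tE] := minor_det2 R m n a a' b b' aa' bb'.
  have := commutes_minor t.
  by rewrite /commutes_at; under eq_fun do rewrite tE; rewrite tE.
have opp s1 s2 : (forall X, det2 R m n X s1 = -1 * det2 R m n X s2) ->
    commutes (fun X => det2 R m n X s2) -> commutes (fun X => det2 R m n X s1).
  by move=> /funext -> /(commutesZ _ _ _ _ _ (-1)).
have zero s1 : (forall X, det2 R m n X s1 = 0) -> commutes (fun X => det2 R m n X s1).
  by move=> /funext ->; exact: commutes_cst.
have lta (a a' : 'I_m) (b b' : 'I_n) : (a < a')%N ->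
    commutes (fun X => det2 R m n X ((a, a'), (b, b'))).
  move=> aa'; have [bb'|b'b|/val_inj->] := ltngtP b b'; first exact: lt.
    by apply: (opp _ ((a, a'), (b', b))) (lt _ _ _ _ aa' b'b) => X; rewrite /det2 /=; ring.
  by apply: zero => X; rewrite /det2 /=; ring.
case: s => -[a a'] [b b']; have [aa'|a'a|/val_inj->] := ltngtP a a'; first exact: lta.
  by apply: (opp _ ((a', a), (b, b'))) (lta _ _ _ _ a'a) => X; rewrite /det2 /=; ring.
by apply: zero => X; rewrite /det2 /=; ring.
Qed.

End Mpc.

(** * Concentration at the barycenter *)

Section Mpc_dirac.
Context (R : realType) (m n : nat) (K : {vspace 'M[R]_(m, n)}).
Variable nu : probability (BMat R m n) R.
Hypothesis nuK : Mpc K nu.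
Let A : BMat R m n := barycenter nu.
Local Notation commutes := (commutes_at _ _ R nu A).

(** Vanishing of [L] describes [K] by finitely many linear equations, one per entry, which makes its
    complement measurable and lets them be integrated. *)
Let L : 'End('M[R]_(m, n)) := (\1 - projv K)%VF.

Let memK X : (X \in K) = (L X == 0).
Proof.
rewrite /L add_lfunE opp_lfunE id_lfunE /= subr_eq0; apply/idP/eqP => [XK|->].
  by rewrite projv_id.
exact: memv_proj.
Qed.

Let Fnu : Filter (nbhs (almost_everywhere nu)).
Proof. exact: (@ae_filter_ringOfSetsType _ (BMat R m n) R nu). Qed.

Lemma commutes_linear (F : 'End('M[R]_(m, n))) i j : commutes (fun X => F X i j).
Proof.
have FE X : F X i j = \sum_a \sum_b F (delta_mx a b) i j * X a b.
  rewrite {1}[X]matrix_sum_delta linear_sum summxE; apply: eq_bigr => a _.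
  rewrite linear_sum summxE; apply: eq_bigr => b _.
  by rewrite linearZ mxE mulrC.
rewrite (_ : (fun _ => _) =
  (fun X : BMat R m n => \sum_a \sum_b F (delta_mx a b) i j * X a b)); last first.
  exact/funext.
do 2 (apply: commutes_sum => ?); apply: commutesZ; exact: commutes_entry nuK _ _.
Qed.

Lemma Mpc_ae_mem : {ae nu, forall X, X \in K}.
Proof.
have [nu0 _ _] := nuK.
suff : nu.-negligible [set X : BMat R m n | X \notin K].
  by apply: negligibleS => X /= /negP.
apply/negligibleP; last exact: nu0.
have -> : [set X : BMat R m n | X \notin K]
    = \bigcup_(ij in [set: 'I_m * 'I_n]) [set X : BMat R m n | L X ij.1 ij.2 != 0].
  apply/seteqP; split => X /=; rewrite memK.
    move=> X0; apply: contrapT => nX; case/negP: X0; apply/eqP/matrixP => i j.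
    rewrite mxE; apply: contrapT => Xij; apply: nX; exists (i, j) => //=.
    exact/eqP.
  by case=> -[i j] _ /=; apply: contra => /eqP ->; rewrite mxE.
apply: fin_bigcup_measurable => // -[i j] _.
have [/(measurable_int _) mL _] := commutes_linear L i j.
have {}mL : measurable_fun setT (fun X : BMat R m n => L X i j) by apply/measurable_EFinP.
rewrite (_ : [set X | _] = setT `&` (fun X : BMat R m n => L X i j) @^-1` (~` [set 0])).
  by apply: mL => //; apply: measurableC; exact: measurable_set1.
by apply/seteqP; split => X /=; [move/eqP|case=> _ /eqP].
Qed.

Lemma barycenter_mem : A \in K.
Proof.
rewrite memK; apply/eqP/matrixP => i j; rewrite mxE.
apply: (commutes_ae_eq0 _ _ _ _ _ _ (commutes_linear L i j)).
by apply: (@filterS _ _ Fnu _ _ _ Mpc_ae_mem) => X; rewrite memK => /eqP ->; rewrite mxE.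
Qed.

(** Expanding leaves a 2x2 minor of [X], terms linear in [X] and a constant, each of which
    commutes. *)
Lemma commutes_det2B s : commutes (fun X => det2 R m n ((X : 'M[R]_(m, n)) - A) s).
Proof.
rewrite (_ : (fun _ => _) = (fun X : BMat R m n =>
  det2 R m n X s + (- A s.1.1 s.2.1 * X s.1.2 s.2.2 + (- A s.1.2 s.2.2 * X s.1.1 s.2.1
    + (A s.1.1 s.2.2 * X s.1.2 s.2.1 + (A s.1.2 s.2.1 * X s.1.1 s.2.2
    + det2 R m n A s)))))); last first.
  by apply/funext => X; rewrite /det2 !mxE; ring.
apply: commutesD; first exact: commutes_det2 nuK _.
do 4 (apply: commutesD; first by (apply: commutesZ; exact: commutes_entry nuK _ _)).
exact: commutes_cst.
Qed.

(** [phi] has integral [phi A = 0] and is positive on [K] away from [A], so almost every [X] equals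
    [A]. *)
Lemma Mpc_is_dirac (c : 'I_m * 'I_m * ('I_n * 'I_n) -> R) :
  (forall X, X \in K -> X != 0 -> 0 < \sum_s c s * det2 R m n X s) ->
  is_dirac nu.
Proof.
move=> cP; pose phi (X : BMat R m n) := \sum_s c s * det2 R m n ((X : 'M[R]_(m, n)) - A) s.
have cphi : commutes phi.
  by apply: commutes_sum => s; apply: commutesZ; exact: commutes_det2B.
have phiA : phi A = 0.
  by rewrite /phi subrr big1 // => s _; rewrite /det2 !mxE !mulr0 subrr mulr0.
have pos X : X \in K -> X != A -> 0 < phi X.
  by move=> XK XA; apply: cP; rewrite ?subr_eq0 // memvB // barycenter_mem.
have phi0 : {ae nu, forall X, phi X = 0}.
  apply: (commutes_ae_ge0 _ _ _ _ _ _ cphi phiA).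
  apply: (@filterS _ _ Fnu _ _ _ Mpc_ae_mem) => X XK.
  by have [->|/(pos _ XK)/ltW //] := eqVneq X A; rewrite phiA.
have XA : {ae nu, forall X, X = A}.
  apply: (@filterS2 _ _ Fnu _ _ _ _ phi0 Mpc_ae_mem) => X X0 XK.
  apply/eqP/negPn/negP => /(pos _ XK).
  by rewrite X0 ltxx.
have null S : measurable S -> ~ S A -> nu S = 0%E.
  move=> mS SA; apply: measure_negligible => //; apply: negligibleS XA => X /= SX XE.
  by apply: SA; rewrite -XE.
exists A => S mS; rewrite diracE; have [AS|AS] := boolP (A \in S); last first.
  by apply: null => // /mem_set; apply/negP.
rewrite -[in LHS](setCK S) probability_setC; last exact: measurableC.
by rewrite null ?sube0 //; [exact: measurableC|apply; exact: set_mem].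
Qed.

End Mpc_dirac.

(** * Mixtures of two Dirac measures *)

Section two_point.
Context (d : measure_display) (T : measurableType d) (R : realType).
Variables (a b : T).
Hypotheses (ma : measurable [set a]) (mb : measurable [set b]) (ab : a <> b).
Import HBNNSimple.

Let half : {nonneg R} := (2^-1)%:nng.

Definition two_point : set T -> \bar R :=
  measure_add (mscale half \d_a) (mscale half \d_b).

HB.instance Definition _ := Measure.on two_point.

Lemma two_pointE S : two_point S = ((2^-1 * (a \in S)%:R + 2^-1 * (b \in S)%:R)%R)%:E.
Proof. by rewrite /two_point measure_addE /mscale /= ?indicE. Qed.

Let two_point_setT : two_point setT = 1%E.
Proof. by rewrite two_pointE !in_setT; congr EFin; rewrite !mulr1; lra. Qed.

HB.instance Definition _ := Measure_isProbability.Build _ _ _ two_point two_point_setT.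

Lemma measurable_integral_two_point (f : T -> \bar R) :
  measurable_fun setT f -> (forall x, 0 <= f x)%E ->
  (\int[two_point]_x f x = (2^-1)%:E * f a + (2^-1)%:E * f b)%E.
Proof.
move=> mf f0; rewrite ge0_integral_measure_add // !ge0_integral_mscale //.
by rewrite !integral_dirac // !diracT !mul1e.
Qed.

(* [f] need not be measurable: the supremum of simple functions defining the
   integral is attained by the one supported on the two atoms. *)
Lemma ge0_integral_two_point (f : T -> R) : (forall x, 0 <= f x) ->
  (\int[two_point]_x (f x)%:E = (2^-1 * f a + 2^-1 * f b)%:E)%E.
Proof.
move=> f0.
have sE (h : {nnsfun T >-> R}) : sintegral two_point h = (2^-1 * h a + 2^-1 * h b)%:E.
  rewrite -integralT_nnsfun measurable_integral_two_point //.
  - exact/measurable_EFinP.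
  - by move=> x; rewrite lee_fin.
have mE c (mc : measurable [set c]) x : mindic R mc x = (x == c)%:R.
  by rewrite /mindic indicE in_set1.
rewrite ge0_integralTE; last by move=> x; rewrite lee_fin.
apply/eqP; rewrite eq_le; apply/andP; split.
  apply/ge_ereal_sup => /= _ [h hf <-]; rewrite sE lee_fin.
  by apply: lerD; rewrite ler_pM2l ?invr_gt0 // -lee_fin hf.
apply: ereal_sup_ubound => /=.
exists (add_nnsfun (scale_nnsfun (indic_nnsfun R ma) (f0 a))
                   (scale_nnsfun (indic_nnsfun R mb) (f0 b))).
  move=> x; rewrite lee_fin /= !mE.
  have [->|xa] := eqVneq x a; last have [->|xb] := eqVneq x b.
  - by rewrite (_ : (a == b) = false) ?mulr1 ?mulr0 ?addr0 //; apply/eqP.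
  - by rewrite ?mulr1 ?mulr0 ?add0r.
  - by rewrite !mulr0 addr0.
rewrite sE /= !mE !eqxx.
rewrite (_ : (a == b) = false); last by apply/eqP.
rewrite (_ : (b == a) = false); last by apply/eqP/nesym.
by rewrite !mulr1 !mulr0 addr0 add0r.
Qed.

(** Positive and negative parts reduce this to the nonnegative case. As [f] is arbitrary, the
    formula applies directly to polyconvex functions. *)
Lemma integral_two_point (f : T -> R) :
  (\int[two_point]_x (f x)%:E = (2^-1 * f a + 2^-1 * f b)%:E)%E.
Proof.
rewrite integralE.
have -> : (fun x => (f x)%:E)^\+%E = (fun x => (Num.max (f x) 0)%:E).
  by apply/funext => x; rewrite funeposE EFin_max.
have -> : (fun x => (f x)%:E)^\-%E = (fun x => (Num.max (- f x) 0)%:E).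
  by apply/funext => x; rewrite funenegE EFin_max EFinN.
rewrite !ge0_integral_two_point; try by move=> x; rewrite le_max lexx orbT.
rewrite -EFinB; congr EFin.
have E (y : R) : Num.max y 0 - Num.max (- y) 0 = y.
  by rewrite /Num.max; case: ltP => h1; case: ltP => h2; lra.
by have := E (f a); have := E (f b); lra.
Qed.

Lemma integrable_two_point (f : T -> R) : measurable_fun setT f ->
  two_point.-integrable setT (fun x => (f x)%:E).
Proof.
move=> mf; apply/integrableP; split; first exact/measurable_EFinP.
under eq_integral do rewrite abse_EFin.
by rewrite integral_two_point ltry.
Qed.

End two_point.

(** * Borel sets of matrices and rank-one lines *)

Section matrix_borel.
Context (R : realType) (m n : nat).

Lemma measurable_closed_matrix (S : set (BMat R m n)) :
  closed (S : set 'M[R]_(m, n)) -> measurable S.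
Proof.
move=> cS; rewrite -[S]setCK; apply: measurableC; apply: sub_sigma_algebra.
exact: closed_openC.
Qed.

Lemma measurable_set1_matrix (X : BMat R m n) : measurable [set X].
Proof.
apply: measurable_closed_matrix; apply: accessible_closed_set1.
by apply: hausdorff_accessible; exact: norm_hausdorff.
Qed.

Lemma continuous_measurable_matrix (f : 'M[R]_(m, n) -> R) :
  continuous f -> measurable_fun setT (f : BMat R m n -> R).
Proof.
move=> cf; apply: (measurability _ (RGenOInfty.measurableE R)) => //.
move=> _ [_ [x ->] <-]; rewrite setTI; apply: sub_sigma_algebra.
by apply: open_comp => // y _; exact: cf.
Qed.

Lemma continuous_minor (s : minor_idx m n) :
  continuous (fun X : 'M[R]_(m, n) => minor s X).
Proof.
apply: continuous_sumr => p; apply: continuous_mulr; first exact: cst_continuous.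
apply: (continuous_big (mul_continuous (K := R))) => i _.
under eq_fun do rewrite mxE.
exact: coord_continuous.
Qed.

End matrix_borel.

(** A minor of size one is an entry. For larger sizes the submatrix has rank at most one, so both
    sides vanish. *)
Lemma rank1_minor (R : realType) (m n : nat) (C : 'M[R]_(m, n)) (t : R)
    (s : minor_idx m n) :
  (\rank C <= 1)%N -> minor s (t *: C) = t * minor s C.
Proof.
case: s => -[k kmn] [[r c] rc] rC; rewrite /minor /=.
case: k kmn r c rc => [|k] kmn r c rc.
  by rewrite !det_mx11 !mxE.
have det0 (D : 'M[R]_(m, n)) : (\rank D <= 1)%N ->
    \det (\matrix_(a < k.+2, b < k.+2) D (r a) (c b)) = 0.
  move=> rD; apply/eqP; rewrite -[_ == 0]negbK -unitfE -unitmxE -row_full_unit.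
  rewrite /row_full neq_ltn.
  (* Selecting rows and columns is multiplication by 0-1 matrices, which cannot raise the rank. *)
  have -> : \matrix_(a < k.+2, b < k.+2) D (r a) (c b)
      = (\matrix_(a < k.+2, i < m) (i == r a)%:R) *m D
        *m (\matrix_(j < n, b < k.+2) (j == c b)%:R).
    apply/matrixP => a b; rewrite !mxE (bigD1 (c b)) //= !mxE eqxx mulr1.
    rewrite (bigD1 (r a)) //= !mxE eqxx mul1r big1 ?addr0 => [|i /negPf ia].
      by rewrite big1 ?addr0 // => j /negPf jb; rewrite [X in _ * X]mxE jb mulr0.
    by rewrite mxE ia mul0r.
  rewrite ltnS (leq_trans (mxrankM_maxl _ _)) //.
  by rewrite (leq_trans (mxrankM_maxr _ _)) // (leq_trans rD).
rewrite !det0 ?mulr0 //.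
by rewrite (leq_trans (mxrankS (scalemx_sub t (submx_refl C)))).
Qed.

Lemma rank1_connection_not_dirac (R : realType) (m n : nat) (K : {vspace 'M[R]_(m, n)}) :
  has_rank1_connection K ->
  exists nu : probability (BMat R m n) R, Mpc K nu /\ ~ is_dirac nu.
Proof.
move=> [A [B [AK BK AB rC]]]; set C := A - B in rC.
have CK : C \in K by rewrite memvB.
have C0 : C <> 0 by rewrite /C => /subr0_eq/eqP; rewrite (negPf AB).
clearbody C; clear AK BK AB.
pose T := BMat R m n.
have m1 (X : T) := measurable_set1_matrix R m n X.
pose nu : probability T R := two_point _ T R (0 : 'M[R]_(m, n)) C.
have bC : barycenter nu = 2^-1 *: C.
  apply/matrixP => i j; rewrite !mxE /Rintegral.
  rewrite (integral_two_point _ T R _ _ (m1 _) (m1 _) (nesym C0) (fun X : T => X i j)).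
  by rewrite /= mxE mulr0 add0r.
exists nu; split.
  split.
- rewrite /nu /= two_pointE !memNset /= ?mulr0 ?addr0 //.
    by rewrite CK.
  by rewrite mem0v.
- move=> s; apply: integrable_two_point => //.
  + exact/nesym.
  + by apply: continuous_measurable_matrix; exact: continuous_minor.
- move=> f [g [cg fE]].
  rewrite (integral_two_point _ T R _ _ (m1 _) (m1 _) (nesym C0) f) bC lee_fin !fE.
  (* Minors are linear along the line through [C], so those of the barycenter are the midpoint of
     those at [0] and [C], and convexity of [g] applies. *)
  have -> : minors (2^-1 *: C) = 2^-1 *: minors (0 : 'M[R]_(m, n)) + (1 - 2^-1) *: minors C.
    apply/ffunP => s; rewrite !ffunE rank1_minor ?rC //.
    rewrite (_ : minor s 0 = 0) ?scaler0 ?add0r.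
      by rewrite /GRing.scale /=; congr (_ * _); lra.
    by rewrite -(scale0r (C : 'M[R]_(m, n))) rank1_minor ?rC // mul0r.
  apply: le_trans (cg _ _ _ _) _; first by apply/andP; split; lra.
  by rewrite (_ : 1 - 2^-1 = 2^-1) //; lra.
(* The singleton of [C] has mass one half, while a Dirac measure takes only the values 0 and 1. *)
move=> [X /(_ [set C] (m1 C))]; rewrite /nu /= two_pointE diracE.
rewrite (mem_set (erefl C : [set C] C)) memNset /=; last exact/nesym.
by move=> [E]; move: E; case: (_ \in _) => /=; lra.
Qed.

Local Close Scope classical_set_scope.

Theorem theorem2 (R : realType) (m n d : nat) (K : {vspace 'M[R]_(m, n)}) :
  (1 <= d <= 3)%N -> \dim K = d ->
  ((forall nu : probability (BMat R m n) R, Mpc K nu -> is_dirac nu)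
   <-> ~ has_rank1_connection K).
Proof.
move=> d13 dK; split=> [all_dirac conn|noconn nu nuK].
  have [nu [nuK]] := rank1_connection_not_dirac R m n K conn.
  by apply; exact: all_dirac.
have [|c cP] := elliptic_det2 R m n K _ noconn; first by rewrite dK.
exact: Mpc_is_dirac nuK c cP.
Qed.
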